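(* Let $G$ be a finite group, $N$ a normal subgroup of $G$, and $T$ a reversible semiregular relative difference set in $G$ with forbidden subgroup $N$ and parameters $(n\lambda,n,n\lambda,\lambda)$, with $T\cap N=\{e\}$. Suppose that $n$ divides $\lambda$. Then for an arbitrary group $U$ of order $\frac{\lambda}{n}$, the graph $$\Gamma=\mathrm{Cay}(G\times U,S),\quad\text{where } S=T^\#\cup H^\#\ \text{ and }\ H=N\times U,$$ is a Neumaier graph with parameters $(n\lambda^2,(n+1)\lambda-2,\lambda-2,1,\lambda)$. Moreover, $\Gamma$ is strongly regular if and only if $n=\lambda$; in this case $\Gamma$ has parameters $(n^3,n^2+n-2,n-2,n+2)$ as a strongly regular graph.
   Context: Here $e$ is the identity of $G$, $G$ and $U$ are regarded as subgroups of $G\times U$, and $X^\#$ is the set of nonidentity elements of $X$. Let $N$ be a normal subgroup of a finite group $G$. A subset $T\subseteq G$ is a relative (to $N$) difference set with forbidden subgroup $N$ and parameters $(m,n,k,\lambda)$ if $m=|G:N|$, $n=|N|$, $k=|T|$, $\lambda$ is a positive integer, every element of $G\setminus N$ has exactly $\lambda$ representations of the form $t_1t_2^{-1}$ with $t_1,t_2\in T$, and no nonidentity element of $N$ has such a representation. It is semiregular if $m=k$ and reversible if $T=\{t^{-1}:t\in T\}$. For an identity-free inverse-closed subset $S$ of a finite group $G$, $\mathrm{Cay}(G,S)$ has vertex set $G$ and the neighbourhood of $g$ is $Sg$. A clique in a regular graph is $m$-regular ($m\ge1$) if every vertex outside it is adjacent to exactly $m$ of its vertices; a regular clique is a clique that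 is $m$-regular for some $m\geq 1$. A Neumaier graph is a non-complete edge-regular graph (a regular graph in which any two adjacent vertices have a fixed number of common neighbours) containing a regular clique; it has parameters $(v,k,\lambda,m,s)$ if it is $k$-regular on $v$ vertices, any two adjacent vertices have exactly $\lambda$ common neighbours, and it has an $m$-regular clique of size $s$. A graph is strongly regular with parameters $(v,k,\lambda,\mu)$ if it is $k$-regular on $v$ vertices, any two adjacent vertices have exactly $\lambda$ common neighbours, and any two distinct non-adjacent vertices have exactly $\mu$ common neighbours.
   Formalization: The Neumaier claim is stated for λ>1 (if n=λ=1 the graph is K_1, which is complete) and the equivalence ''strongly regular iff n=λ'' for n>1 (if n=1<λ the graph is the λ×λ rook graph, strongly regular with n≠λ). *)

(* Defs.v *)
From mathcomp Require Import all_boot all_fingroup.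
Set Implicit Arguments.
Unset Strict Implicit.
Unset Printing Implicit Defensive.
Import GroupScope.

Definition diff_reps (gT : finGroupType) (T : {set gT}) (x : gT) : nat :=
  #|[set t in setX T T | t.1 * t.2^-1 == x]|.

Definition relative_difference_set (gT : finGroupType) (G N : {group gT})
    (T : {set gT}) (m n k lam : nat) : Prop :=
  [/\ N <| G /\ T \subset G,
      [/\ m = #|G : N|, n = #|N| & k = #|T|],
      (0 < lam)%N,
      forall x, x \in G :\: N -> diff_reps T x = lam
    & forall x, x \in N^# -> diff_reps T x = 0%N].

Definition semiregular_rds (gT : finGroupType) (G N : {group gT})
    (T : {set gT}) (m n k lam : nat) : Prop :=
  relative_difference_set G N T m n k lam /\ m = k.

Definition reversible (gT : finGroupType) (T : {set gT}) : Prop :=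
  T = [set t^-1 | t in T].

(* A graph is a relation on a finite vertex type. That the relation is        *)
(* symmetric and irreflexive is part of [regular_graph], hence of all the     *)
(* graph classes below.                                                       *)
Definition simple_graph (V : finType) (e : rel V) : Prop :=
  symmetric e /\ irreflexive e.

Definition complete_graph (V : finType) (e : rel V) : Prop :=
  forall x y, x != y -> e x y.

Definition regular_graph (V : finType) (e : rel V) (k : nat) : Prop :=
  simple_graph e /\ forall x, #|[set y | e x y]| = k.

Definition common_neighbours (V : finType) (e : rel V) (x y : V) : {set V} :=
  [set z | e x z && e y z].

Definition edge_regular (V : finType) (e : rel V) (v k l : nat) : Prop :=
  [/\ #|V| = v, regular_graph e k
    & forall x y, e x y -> #|common_neighbours e x y| = l].

Definition is_clique (V : finType) (e : rel V) (C : {set V}) : Prop :=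
  {in C &, forall x y, x != y -> e x y}.

Definition regular_clique (V : finType) (e : rel V) (m : nat) (C : {set V}) :
    Prop :=
  [/\ (1 <= m)%N, is_clique e C
    & forall x, x \notin C -> #|[set y in C | e x y]| = m].

Definition neumaier (V : finType) (e : rel V) : Prop :=
  [/\ ~ complete_graph e,
      exists v k l : nat, edge_regular e v k l
    & exists (m : nat) (C : {set V}), regular_clique e m C].

Definition neumaier_params (V : finType) (e : rel V) (v k l m s : nat) : Prop :=
  [/\ neumaier e, edge_regular e v k l
    & exists C : {set V}, regular_clique e m C /\ #|C| = s].

Definition strongly_regular_params (V : finType) (e : rel V)
    (v k l mu : nat) : Prop :=
  edge_regular e v k l /\
  forall x y, x != y -> ~~ e x y -> #|common_neighbours e x y| = mu.

Definition strongly_regular (V : finType) (e : rel V) : Prop :=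
  exists v k l mu : nat, strongly_regular_params e v k l mu.

Definition cayley (gT : finGroupType) (S : {set gT}) : rel gT :=
  fun g x => x \in S :* g.

(* The connection set T^# :|: H^# with H = N x U; T is viewed inside the      *)
(* direct product gT * uT through [pairg1], i.e. t |-> (t, 1).                *)
Definition connection_set (gT uT : finGroupType) (N : {group gT})
    (T : {set gT}) : {set gT * uT} :=
  (pairg1 uT @: T)^# :|: (setX N [set: uT])^#.

(* Main.v *)
Require Import Defs.
From mathcomp Require Import all_boot all_fingroup.
From mathcomp Require Import zify.
Set Implicit Arguments.
Unset Strict Implicit.
Unset Printing Implicit Defensive.
Import GroupScope.

(** For d <> e, the number of common neighbours of two vertices with quotient
    d is the coefficient of d in S^2, computed in the integral group ring of
    G x U. There S = T + H - 2e, while T^2 = n lam e + lam (G - N) because T is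
    a reversible relative difference set, H^2 = lam H because H is a subgroup
    of order lam, and T H = H T = G x U because T is a transversal of N.
    Hence that coefficient, plus 4 if d is in S, equals 2, plus lam if d lies
    in G or in H. Outside S the values lam + 2 and 2 both occur, unless U is
    trivial. *)

(** * Cayley graphs and their common-neighbour counts *)

Section CayleyGraph.

Variables (gT : finGroupType) (S : {set gT}).
Hypotheses (S1 : 1 \notin S) (SV : forall x, (x^-1 \in S) = (x \in S)).

(** The coefficient of [d] in the group ring product of the inverses of [A] with [B]; for
    inverse-closed [A] it is the coefficient of [d] in AB. *)
Definition translate_count (A B : {set gT}) (d : gT) : nat :=
  #|[set x in A | x * d \in B]|.

Lemma cayleyE x y : cayley S x y = (x * y^-1 \in S).
Proof. by rewrite /cayley mem_rcoset -SV invMg invgK. Qed.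

Lemma cayley_regular : regular_graph (cayley S) #|S|.
Proof.
split=> [|x].
  split=> [x y|x]; first by rewrite !cayleyE -SV invMg invgK.
  by rewrite cayleyE mulgV (negbTE S1).
by rewrite -(card_rcoset S x); apply: eq_card => y; rewrite inE.
Qed.

(** Put [z = s * x]: then [z * x^-1 = s] and [z * y^-1 = s * (x * y^-1)]. *)
Lemma card_common_neighbours x y :
  #|common_neighbours (cayley S) x y| = translate_count S S (x * y^-1).
Proof.
rewrite /translate_count -[RHS](card_imset _ (mulIg x)); apply: eq_card => z.
apply/idP/imsetP => [|[s]].
  rewrite inE /cayley !mem_rcoset => /andP[zx zy].
  by exists (z * x^-1); rewrite ?mulgKV // inE zx mulgA mulgKV.
rewrite !inE /cayley !mem_rcoset => /andP[sS sdS] ->.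
by rewrite mulgK sS -mulgA.
Qed.

End CayleyGraph.

(** * Translate counts as sums of indicators *)

Lemma sum_indicator (T : finType) (A : {set T}) :
  (\sum_x (x \in A) = #|A|)%N.
Proof. by rewrite -sum1_card [RHS]big_mkcond. Qed.

Lemma translate_count_sum (gT : finGroupType) (A B : {set gT}) d :
  translate_count A B d = (\sum_x (x \in A) * (x * d \in B)%g)%N.
Proof.
rewrite /translate_count -sum_indicator; apply: eq_bigr => x _.
by rewrite inE; case: (x \in A); case: (_ \in B).
Qed.

Lemma translate_countC (gT : finGroupType) (A B : {set gT}) d :
  translate_count A B d = translate_count B A d^-1.
Proof.
rewrite /translate_count -(card_imset _ (mulIg d)); apply: eq_card => z.
apply/imsetP/idP => [[x]|].
  by rewrite !inE => /andP[xA xB] ->; rewrite mulgK xB.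
rewrite inE => /andP[zB zA].
by exists (z * d^-1); rewrite ?mulgKV // inE zA mulgKV.
Qed.

Lemma translate_count_group (gT : finGroupType) (H : {group gT}) d :
  translate_count H H d = ((d \in H) * #|H|)%N.
Proof.
rewrite /translate_count; case: (boolP (d \in H)) => dH.
  rewrite mul1n; apply: eq_card => x; rewrite inE.
  by case: (boolP (x \in H)) => //= xH; rewrite groupMl.
apply/eqP; rewrite mul0n cards_eq0; apply/eqP/setP=> x; rewrite !inE.
by case: (boolP (x \in H)) => //= xH; rewrite groupMl // (negbTE dH).
Qed.

(** * The square of a union of two sets meeting only in the identity, with the identity removed *)

Section PuncturedUnion.

Variables (gT : finGroupType) (A B : {set gT}).
Hypothesis AB1 : A :&: B = 1.

Let S := A^# :|: B^#.

(** The group ring identity S = A + B - 2e, freed of subtraction to live in [nat]. *)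
Lemma punctured_union_indicator x :
  ((x \in S) + 2 * (x == 1%g) = (x \in A) + (x \in B))%N.
Proof.
have /setP/(_ x) := AB1; rewrite !inE.
by case: (x == 1); case: (x \in A); case: (x \in B).
Qed.

Lemma card_punctured_union : (#|S| + 2 = #|A| + #|B|)%N.
Proof.
rewrite -!sum_indicator -big_split /=.
under [RHS]eq_bigr => x _ do rewrite -punctured_union_indicator.
rewrite big_split /= -big_distrr /=; congr (_ + _)%N.
by under eq_bigr => x _ do rewrite -in_set1; rewrite sum_indicator cards1.
Qed.

(** Compare coefficients in (S + 2e)^2 = S^2 + 4S + 4e = (A + B)^2, where inverses are taken in each
    left factor; 4e does not contribute at [d != 1]. *)
Lemma translate_count_punctured_union d :
    d != 1 -> (forall x, (x^-1 \in S) = (x \in S)) ->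
  (translate_count S S d + 4 * (d \in S) =
   translate_count A A d + translate_count A B d +
   (translate_count B A d + translate_count B B d))%N.
Proof.
move=> d1 SV.
have delta (f : gT -> nat) c : (\sum_x (x == c) * f x = f c)%N.
  rewrite (bigD1 c) //= eqxx mul1n big1 ?addn0 // => x /negbTE->.
  by rewrite mul0n.
(* The two cross terms, equal because [S] is inverse-closed, and the square of 2e, which
   vanishes. *)
have -> : (4 * (d \in S) = \sum_(x : gT) (2 * ((x == 1%g) * (x * d \in S)%g) +
    2 * ((x == d^-1) * (x \in S)) +
    4 * ((x == 1%g) * (x * d == 1)%g)))%N.
  rewrite !big_split /= !delta big1_eq mul1g SV (negbTE d1).
  by case: (d \in S).
rewrite !translate_count_sum -!big_split /=; apply: eq_bigr => x _.
have Dx : (x == d^-1) = (x * d == 1) by rewrite eq_mulgV1 invgK.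
have := punctured_union_indicator x.
have := punctured_union_indicator (x * d).
(* The right side factors into the indicators of A + B at [x] and at [x * d]; each becomes that of S
   + 2e. *)
rewrite Dx -!(mulnDr (x \in _)) -mulnDl => <- <-.
move: (x \in S) (x * d \in S) (x == 1) (x * d == 1).
by do 4!case.
Qed.

End PuncturedUnion.

(** * Reversible relative difference sets and transversality *)

Section RelativeDifferenceSet.

Variables (gT : finGroupType) (N : {group gT}) (T : {set gT}).
Hypothesis revT : reversible T.

Lemma reversibleV t : (t^-1 \in T) = (t \in T).
Proof.
by rewrite {1}revT; apply/imsetP/idP => [[u uT /invg_inj->]|tT] //; exists t.
Qed.

(** If [d = t * u^-1], then [x = t^-1] and [x * d = u^-1] lie in [T] by reversibility, and
    conversely. *)
Lemma diff_reps_translate d : diff_reps T d = translate_count T T d.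
Proof.
pose f t := (t^-1, (t * d)^-1).
have f_inj : injective f by move=> t u [/invg_inj].
rewrite /translate_count -[RHS](card_imset _ f_inj); apply: eq_card => -[t u].
apply/idP/imsetP => [|[x]].
  rewrite !inE /= => /andP[/andP[tT uT] /eqP def_d].
  exists t^-1; last by rewrite /f -def_d mulKg !invgK.
  by rewrite inE -def_d mulKg !reversibleV tT.
rewrite !inE => /andP[xT xdT] [-> ->].
by rewrite !reversibleV xT xdT invgK mulKg /=.
Qed.

Hypotheses (cardT : #|T| = #|[set: gT] : N|).
Hypothesis T_forbidden : forall x, x \in N^# -> diff_reps T x = 0%N.

Lemma forbidden_rcoset_inj t u : t \in T -> u \in T -> t * u^-1 \in N -> t = u.
Proof.
move=> tT uT tuN; apply/eqP; rewrite eq_mulgV1; apply: contraT => tu1.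
have /eqP : diff_reps T (t * u^-1) = 0%N.
  by apply: T_forbidden; rewrite !inE tu1.
by rewrite cards_eq0 => /eqP/setP/(_ (t, u)); rewrite !inE tT uT eqxx.
Qed.

(** Each right coset of [N] holds at most one element of [T], and [T] has as many elements as there
    are cosets, so [T] meets the coset of [g^-1] exactly once. *)
Lemma forbidden_transversal g : #|[set t in T | t * g \in N]| = 1%N.
Proof.
have inj : {in T &, injective (rcoset N)}.
  move=> t u tT uT; rewrite !rcosetE => eq_tu.
  by apply: forbidden_rcoset_inj => //; rewrite -mem_rcoset -eq_tu rcoset_refl.
have im : rcoset N @: T = rcosets N [set: gT].
  apply/eqP; rewrite eqEcard card_in_imset // cardT leqnn andbT.
  by rewrite imsetS // subsetT.
have : rcoset N g^-1 \in rcosets N [set: gT] by rewrite imset_f ?inE.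
rewrite -im => /imsetP[t tT]; rewrite !rcosetE => /eqP.
rewrite eq_sym -(rcosetE N t) => Egt.
have tgN : t * g \in N.
  by rewrite -[g]invgK -mem_rcoset -(eqP Egt) rcosetE rcoset_refl.
apply/eqP/cards1P; exists t; apply/setP=> u; rewrite !inE.
apply/andP/eqP => [[uT ugN]|-> //]; apply: forbidden_rcoset_inj => //.
by rewrite -(mulgK g u) -mulgA -invMg groupM ?groupV.
Qed.

End RelativeDifferenceSet.

(** * The connection set in the direct product *)

Section ProductGraph.

Variables (gT uT : finGroupType) (N : {group gT}) (T : {set gT}).
Variables (n lam : nat).
Hypothesis rdsT : semiregular_rds [set: gT] N T (n * lam) n (n * lam) lam.
Hypothesis revT : reversible T.
Hypothesis TN : T :&: N = [set 1].
Hypothesis n_dvd_lam : n %| lam.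
Hypothesis cardU : #|[set: uT]| = (lam %/ n)%N.

Let H := [group of setX N [set: uT]].
Let T1 := pairg1 uT @: T.
Let S := connection_set uT N T.

Let cardN : #|N| = n. Proof. by case: rdsT => -[_ [_ <-]]. Qed.
Let cardT : #|T| = (n * lam)%N. Proof. by case: rdsT => -[_ [_ _ <-]]. Qed.
Let indexN : #|[set: gT] : N| = (n * lam)%N.
Proof. by case: rdsT => -[_ [<-]]. Qed.
Let lam_gt0 : (0 < lam)%N. Proof. by case: rdsT => -[]. Qed.
Let n_gt0 : (0 < n)%N. Proof. by rewrite -cardN cardG_gt0. Qed.

Let T_forbidden x : x \in N^# -> diff_reps T x = 0%N.
Proof. by case: rdsT => -[_ _ _ _ forb] _; apply: forb. Qed.

Let T_reps x : x \notin N -> diff_reps T x = lam.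
Proof. by case: rdsT => -[_ _ _ reps _] _ xN; apply: reps; rewrite !inE xN. Qed.

Let transversalT g : #|[set t in T | t * g \in N]| = 1%N.
Proof. by apply: forbidden_transversal => //; rewrite cardT. Qed.

Lemma pairg1_inj : injective (pairg1 uT : gT -> gT * uT).
Proof. by move=> x y []. Qed.

Lemma card_product : #|{: gT * uT}| = (n * lam ^ 2)%N.
Proof.
rewrite card_prod -!cardsT cardU -(Lagrange (subsetT N)) indexN cardN.
have := divnK n_dvd_lam; move: (lam %/ n) => q <-.
by rewrite -mulnn; lia.
Qed.

Lemma card_H : #|H| = lam.
Proof. by rewrite cardsX cardN cardU muln_divA // mulKn. Qed.

Lemma mem_H x : (x \in H) = (x.1 \in N).
Proof. by rewrite !inE andbT. Qed.

Lemma mem_T1 x : (x \in T1) = (x.1 \in T) && (x.2 == 1).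
Proof.
case: x => g u /=; apply/imsetP/andP => [[t tT [-> ->]]|[gT1 /eqP->]] //.
by exists g.
Qed.

Lemma T1_capH : T1 :&: H = 1.
Proof.
apply/setP=> -[g u]; rewrite inE mem_T1 mem_H !inE /= andbAC.
have /setP/(_ g) := TN; rewrite !inE => ->.
by rewrite xpair_eqE.
Qed.

Lemma card_T1 : #|T1| = (n * lam)%N.
Proof. by rewrite (card_imset _ pairg1_inj). Qed.

Lemma connection_setV x : (x^-1 \in S) = (x \in S).
Proof.
rewrite ![_ \in S]inE !in_setD1 !mem_T1 !mem_H /= reversibleV //.
by rewrite groupV !invg_eq1.
Qed.

Lemma connection_set1 : 1 \notin S.
Proof. by rewrite !inE eqxx. Qed.

Lemma card_connection_set : #|S| = ((n + 1) * lam - 2)%N.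
Proof.
have := card_punctured_union T1_capH; rewrite card_T1 card_H mulnDl mul1n => <-.
by rewrite addnK.
Qed.

(** [H] leaves the second component free, so only [d.1] matters and the transversal property of [T]
    applies. *)
Lemma translate_count_T1H d : translate_count T1 H d = 1%N.
Proof.
rewrite -(transversalT d.1) -[RHS](card_imset _ pairg1_inj).
apply: eq_card => -[g u].
rewrite inE mem_T1 mem_H /=.
apply/andP/imsetP => [[/andP[gT1 /eqP->] gdN]|[t]].
  by exists g; rewrite // inE gT1.
by rewrite inE => /andP[tT tdN] [-> ->]; rewrite tT eqxx.
Qed.

Lemma translate_count_T1 d : d != 1 ->
  translate_count T1 T1 d = (((d.2 == 1%g) && (d.1 \notin N)) * lam)%N.
Proof.
move=> d1; case: (eqVneq d.2 1) => [d2|d2] /=; last first.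
  apply/eqP; rewrite mul0n cards_eq0; apply/eqP/setP=> -[g u].
  rewrite !inE !mem_T1 /=; apply/negP => /andP[/andP[_ /eqP->]].
  by rewrite mul1g (negbTE d2) andbF.
have -> : translate_count T1 T1 d = diff_reps T d.1.
  rewrite diff_reps_translate // /translate_count.
  rewrite -[RHS](card_imset _ pairg1_inj).
  apply: eq_card => -[g u]; rewrite inE !mem_T1 /= d2 mulg1.
  apply/andP/imsetP => [[/andP[gT1 /eqP->] /andP[gdN _]]|[t]].
    by exists g; rewrite // inE gT1.
  by rewrite inE => /andP[tT tdN] [-> ->]; rewrite tT tdN eqxx.
case: (boolP (d.1 \in N)) => dN; last by rewrite mul1n T_reps.
rewrite mul0n T_forbidden // !inE dN andbT.
by apply: contraNneq d1 => d1; rewrite [d]surjective_pairing d1 d2.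
Qed.

(** The two mixed products give the 2. The squares of [T1] and [H] give [lam] on the disjoint sets G
    - N and H, whose union, away from the identity, is that of G and H. *)
Lemma translate_count_connection_set d : d != 1 ->
  (translate_count S S d + 4 * (d \in S) =
   2 + ((d.2 == 1%g) || (d.1 \in N)) * lam)%N.
Proof.
move=> d1; rewrite (translate_count_punctured_union T1_capH d1 connection_setV).
rewrite translate_count_T1 // translate_count_T1H.
rewrite (translate_countC H) translate_count_T1H translate_count_group.
rewrite card_H mem_H.
by case: (d.2 == 1); case: (d.1 \in N); rewrite /= ?mul0n ?mul1n; lia.
Qed.

(** * Neumaier and strong regularity of the graph *)

Let Gamma : rel (gT * uT) := cayley S.

Lemma Gamma_edge x y : Gamma x y = (x * y^-1 \in S).
Proof. exact: cayleyE connection_setV _ _. Qed.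

(** On an edge the quotient lies in [S], hence in G or [H], and the count c satisfies c + 4 = 2 +
    lam. *)
Lemma Gamma_edge_regular :
  edge_regular Gamma (n * lam ^ 2) ((n + 1) * lam - 2) (lam - 2).
Proof.
split; first exact: card_product.
  rewrite -card_connection_set.
  exact: cayley_regular connection_set1 connection_setV.
move=> x y; rewrite Gamma_edge card_common_neighbours => dS.
have d1 : x * y^-1 != 1 by apply: contraNneq connection_set1 => <-.
have := translate_count_connection_set d1; rewrite dS.
have -> : ((x * y^-1).2 == 1) || ((x * y^-1).1 \in N).
  move: dS; rewrite [_ \in S]inE !in_setD1 mem_T1 mem_H.
  by case/orP => /andP[_]; [case/andP=> _ -> | move=> ->; rewrite orbT].
by rewrite mul1n muln1; move: (translate_count _ _ _) => c; lia.
Qed.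

Lemma Gamma_nonadjacent x y : x != y -> ~~ Gamma x y ->
  #|common_neighbours Gamma x y| =
    (2 + (((x * y^-1).2 == 1) || ((x * y^-1).1 \in N))%g * lam)%N.
Proof.
move=> xy; rewrite Gamma_edge card_common_neighbours => /negbTE dS.
have d1 : x * y^-1 != 1 by rewrite -eq_mulgV1.
by have := translate_count_connection_set d1; rewrite dS muln0 addn0.
Qed.

(** For [x] outside the subgroup [H] and [y] in it, [y * x^-1] is not in [H], so adjacency means
    [y * x^-1] is in [T1]; the transversal count allows exactly one such [y]. *)
Lemma Gamma_regular_clique : regular_clique Gamma 1 H.
Proof.
split=> // [x y xH yH xy|x xH].
  rewrite Gamma_edge [_ \in S]inE !in_setD1 -eq_mulgV1 xy /=.
  by rewrite (groupM xH) ?groupV ?orbT.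
rewrite -(translate_count_T1H x) translate_countC; apply: eq_card => y.
rewrite in_set [in RHS]in_set /Gamma /cayley mem_rcoset.
case: (boolP (y \in H)) => //= yH.
have yxH : y * x^-1 \notin H by rewrite groupMl // groupV.
rewrite [_ \in S]inE !in_setD1 (negbTE yxH) andbF orbF.
by rewrite (group1_contra yxH).
Qed.

Lemma Gamma_not_complete : (1 < lam)%N -> ~ complete_graph Gamma.
Proof.
move=> lam_gt1 complete.
have [_ [[_ irr] deg] _] := Gamma_edge_regular.
have := deg 1; have -> : [set y | Gamma 1 y] = [set~ 1].
  apply/setP=> y; rewrite !inE; case: (eqVneq y 1) => [->|y1] //=.
  by apply: complete; rewrite eq_sym.
have := cardsC1 (1 : gT * uT); rewrite card_product => ->.
(* Equality of n lam^2 - 1 and (n + 1) lam - 2 would mean (n lam - 1)(lam - 1) = 0. *)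
move: lam_gt1 n_gt0; case: lam => [|[|l]] // _; case: n => // k _.
nia.
Qed.

Lemma exists_outside_union : (1 < n)%N -> exists2 g, g \notin N & g \notin T.
Proof.
move=> n_gt1.
have [/subsetP NT|] := boolP ([set: gT] \subset T :|: N); last first.
  by case/subsetPn=> g _; rewrite !inE negb_or => /andP[gNT gN]; exists g.
have TUN : T :|: N = [set: gT] by apply/setP=> g; rewrite (NT g) inE.
(* If [T] and [N] covered G, then n^2 lam + 1 = n lam + n, that is (n lam - 1)(n - 1) = 0. *)
have := cardsUI T N; rewrite TUN TN cards1 cardT cardN.
rewrite -(Lagrange (subsetT N)) indexN cardN.
nia.
Qed.

(** With [g] outside [T] and [N], every [(g, u)] is non-adjacent to the identity, with [2 + lam]
    common neighbours if [u = 1] and 2 otherwise. A constant [mu] forces [uT] to be trivial, so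
    [lam %/ n = 1]. *)
Lemma strongly_regular_eq : (1 < n)%N -> strongly_regular Gamma -> n = lam.
Proof.
move=> n_gt1 [v [k [l [mu [_ nonadj]]]]].
have [g gN gNT] := exists_outside_union n_gt1.
have count (u : uT) : mu = (2 + (u == 1%g) * lam)%N.
  have g1 : (g, u) != 1 :> gT * uT by apply: contraNneq gN => -[->].
  have gS : ~~ Gamma (g, u) 1.
    rewrite Gamma_edge invg1 mulg1 [_ \in S]inE !in_setD1 mem_T1 mem_H /=.
    by rewrite (negbTE gN) (negbTE gNT) !andbF.
  rewrite -(nonadj _ _ g1 gS) Gamma_nonadjacent // invg1 mulg1 /=.
  by rewrite (negbTE gN) orbF.
have U1 u : u = 1 :> uT.
  apply/eqP; apply: contraT => /negbTE u1.
  by have := count 1; rewrite (count u) u1 eqxx; lia.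
have := divnK n_dvd_lam; rewrite -cardU.
have -> : [set: uT] = [set 1] by apply/setP=> u; rewrite !inE (U1 u) eqxx.
by rewrite cards1 mul1n.
Qed.

(** Here [uT] is trivial, so every quotient lies in G and all non-adjacent pairs have [2 + lam]
    common neighbours. *)
Lemma eq_strongly_regular : n = lam ->
  strongly_regular_params Gamma (n ^ 3) (n ^ 2 + n - 2) (n - 2) (n + 2).
Proof.
move=> n_lam; split=> [|x y xy nxy].
  have := Gamma_edge_regular; rewrite -n_lam.
  by rewrite -expnS mulnDl mul1n mulnn.
have /eqP/cards1P[u0 U1] : #|[set: uT]| = 1%N.
  by rewrite cardU -n_lam divnn n_gt0.
have U_trivial u : u = 1 :> uT.
  have := in_setT (1 : uT); have := in_setT u.
  by rewrite U1 !inE => /eqP-> /eqP->.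
by rewrite Gamma_nonadjacent // [(x * _).2]U_trivial eqxx mul1n -n_lam addnC.
Qed.

End ProductGraph.

(** The bounds exclude degenerate cases. For [lam = 1] the graph is a single vertex, hence complete.
    For [n = 1] it is the [lam] by [lam] rook's graph, strongly regular for every [lam]. *)
Theorem lemma4p1 (gT : finGroupType) (N : {group gT}) (T : {set gT})
    (n lam : nat)
    (normalN : N <| [set: gT])
    (rdsT : semiregular_rds [set: gT] N T (n * lam) n (n * lam) lam)
    (revT : reversible T)
    (TN : T :&: N = [set 1])
    (n_dvd_lam : n %| lam)
    (uT : finGroupType)
    (cardU : #|[set: uT]| = (lam %/ n)%N) :
  let Gamma : rel (gT * uT) := cayley (connection_set uT N T) in
  [/\ (1 < lam)%N ->
        neumaier_params Gamma
          (n * lam ^ 2) ((n + 1) * lam - 2) (lam - 2) 1 lam,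
      (1 < n)%N -> (strongly_regular Gamma <-> n = lam)
    & n = lam ->
        strongly_regular_params Gamma (n ^ 3) (n ^ 2 + n - 2) (n - 2) (n + 2)].
Proof.
split=> [lam_gt1|n_gt1|].
- have C := Gamma_regular_clique uT rdsT revT.
  have er := Gamma_edge_regular rdsT revT TN n_dvd_lam cardU.
  split=> //; last by eexists; split; [exact: C | exact: card_H rdsT _ _].
  split; first exact: Gamma_not_complete rdsT revT TN n_dvd_lam cardU lam_gt1.
    by do 3!eexists; exact: er.
  by do 2!eexists; exact: C.
- split=> [|n_lam].
    exact: (strongly_regular_eq rdsT revT TN n_dvd_lam cardU).
  do 4!eexists; exact: (eq_strongly_regular rdsT revT TN n_dvd_lam cardU).
- exact: (eq_strongly_regular rdsT revT TN n_dvd_lam cardU).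
Qed.
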